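(* Let $H$ be a unimodular ribbon Hopf algebra over an algebraically closed field $\Bbbk$, with left integral $\lambda\in H^*$ and two-sided cointegral $\Lambda\in H$ normalized by $\lambda(\Lambda)=1$. The Kerler--Lyubashenko functor $J_4:4\mathrm{HB}\to H\text{-mod}$ satisfies $$J_4(S^2\times D^2)=\lambda(1),\qquad J_4(S^1\times D^3)=\varepsilon(\Lambda).$$ In particular, $J_4(S^2\times D^2)\neq0$ if and only if $H$ is cosemisimple (in the sense that $H^*$ is semisimple), and $J_4(S^1\times D^3)\neq0$ if and only if $H$ is semisimple.
   Context: **Hopf algebra.** $H$ is a finite-dimensional ribbon Hopf algebra with coproduct $\Delta(x)=x_{(1)}\otimes x_{(2)}$, counit $\varepsilon$, antipode $S$, R-matrix $R$ and ribbon element. A left integral $\lambda\in H^*$ satisfies $\lambda(x_{(2)})x_{(1)}=\lambda(x)1$ for all $x\in H$; a left cointegral $\Lambda\in H$ satisfies $x\Lambda=\varepsilon(x)\Lambda$ for all $x\in H$; both are nonzero and unique up to scalar. $H$ is unimodular if $S(\Lambda)=\Lambda$. $H\text{-mod}$ is the (unimodular ribbon) category of finite-dimensional left $H$-modules. The adjoint representation $\mathrm{ad}$ is $H$ with action $h\triangleright x=h_{(1)}xS(h_{(2)})$; it is the end $\int_{V}V\otimes V^*$ with structure morphisms $j_V(x)=\sum_i(x\cdot v_i)\otimes f_i$ for dual bases $\{v_i\}$, $\{f_i\}$ of $V$, $V^*$. Then $\lambda:\mathrm{ad}\to\Bbbk$ and $\Lambda:\Bbbk\to\mathrm{ad}$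 are intertwiners. **Handlebodies.** $4\mathrm{HB}$ is Bobtcheva--Piergallini's category of connected $4$-dimensional $2$-handlebodies up to $2$-deformation. Endomorphisms of its tensor unit $0$ are connected $4$-dimensional $2$-handlebodies obtained from $D^4$ by attaching $1$- and $2$-handles, up to isotopies of attaching maps, slides of $i$-handles over $i$-handles ($i\le2$), and creation/removal of canceling pairs of handles of index $0/1$ and $1/2$. Such handlebodies are presented by Kirby links: dotted $0$-framed unknots stand for $1$-handles, undotted framed components for $2$-handles. $S^2\times D^2$ is given the handle decomposition with a single $2$-handle attached along an undotted $0$-framed unknot, and $S^1\times D^3$ the one with a single $1$-handle (one dotted unknot). **The functor $J_4$ on endomorphisms of $0$.** (Scalars are identified with endomorphisms of the trivial module.) Let a Kirby link have dotted components $U_1,\dots,U_d$ and undotted components $K_1,\dots,K_k$. Cut all strands crossing the Seifert disc of $U_i$, open up this disc, and bring both of its sides down to the bottom line as the $i$th block of bottom endpoints, whose left half is joined to its right half by nested pairing; cut each $K_s$ at one point brought to the top line, so it becomes the $s$th top arc. Color the arcs by modules $X_1,\dots,X_k$ so that the top endpoints give $X_1\otimes X_1^*\otimes\cdots\otimes X_k\otimes X_k^*$; the $i$th bottom block gives $Y_i\otimes Y_i^*$, with $Y_i$ a tensor product of the $X_s$ and their duals. The Reshetikhin--Turaev evaluation of the resulting tangle composed with $j_{Y_1}\otimes\cdots\otimes j_{Y_d}$ is dinatural in the $X_s$, hence equals $(j_{X_1}\otimes\cdots\otimes j_{X_k})\circ\Phi$ for a unique intertwiner $\Phi:\mathrm{ad}^{\otimes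 d}\to\mathrm{ad}^{\otimes k}$, and $J_4$ of the handlebody is $\lambda^{\otimes k}\circ\Phi\circ\Lambda^{\otimes d}$. *)

(* Defs.v *)
From HB Require Import structures.
From mathcomp Require Import all_boot all_order all_algebra all_field.
From mathcomp Require Import boolp classical_sets.

Set Implicit Arguments.
Unset Strict Implicit.
Unset Printing Implicit Defensive.

Import GRing.Theory.
Local Open Scope ring_scope.

(** * Tensor products of finite-dimensional vector spaces

    [tens V W] is V ⊗ W in coordinates with respect to the chosen bases
    [vbasis] of V and W.  The Sweedler notation [\tsum_(a, b <- t) E] is the
    image of t under the linear map V ⊗ W -> U induced by the bilinear map
    (a, b) |-> E.  Below it is only used when E is bilinear in (a, b), so that
    no construction depends on the chosen bases. *)

Definition tens (K : fieldType) (V W : vectType K) : vectType K :=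
  'M[K]_(\dim {:V}, \dim {:W}).

Definition basis_vec (K : fieldType) (V : vectType K) (i : 'I_(\dim {:V})) : V :=
  (vbasis {:V})`_i.

Definition dual_basis_vec (K : fieldType) (V : vectType K) (i : 'I_(\dim {:V})) :
  'Hom(V, K^o) := linfun (coord (vbasis {:V}) i : V -> K^o).

Definition tpure (K : fieldType) (V W : vectType K) (v : V) (w : W) : tens V W :=
  \matrix_(i, j) (coord (vbasis {:V}) i v * coord (vbasis {:W}) j w).

Definition tlift (K : fieldType) (V W U : vectType K) (B : V -> W -> U)
    (t : tens V W) : U :=
  \sum_i \sum_j (t : 'M[K]_(\dim {:V}, \dim {:W})) i j *:
     B (basis_vec i) (basis_vec j).

Notation "v ⊗ w" := (tpure v w) (at level 38, right associativity) : ring_scope.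
Notation "'\tsum_' ( a , b <- t ) E" := (tlift (fun a b => E) t)
  (at level 41, a name, b name, t at level 60, E at level 41,
   format "'\tsum_' ( a ,  b  <-  t )  E") : ring_scope.

(** [A] carries a bilinear product [mul] and a unit [one], given explicitly so
    that the notions apply both to H and to its dual algebra. *)
Definition is_amodule (K : fieldType) (A : vectType K) (mul : A -> A -> A)
    (one : A) (V : vectType K) (act : A -> V -> V) : Prop :=
  [/\ forall (c : K) (a b : A) (v : V), act (c *: a + b) v = c *: act a v + act b v,
      forall (c : K) (a : A) (v w : V), act a (c *: v + w) = c *: act a v + act a w,
      forall v : V, act one v = v
    & forall (a b : A) (v : V), act (mul a b) v = act a (act b v)].

Definition stable_subspace (K : fieldType) (A V : vectType K) (act : A -> V -> V)
    (U : {vspace V}) : Prop :=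
  forall (a : A) (v : V), v \in U -> act a v \in U.

Definition simple_submodule (K : fieldType) (A V : vectType K)
    (act : A -> V -> V) (U : {vspace V}) : Prop :=
  [/\ U <> 0%VS, stable_subspace act U
    & forall W : {vspace V}, (W <= U)%VS -> stable_subspace act W ->
        W = 0%VS \/ W = U].

Definition semisimple_module (K : fieldType) (A V : vectType K)
    (act : A -> V -> V) : Prop :=
  exists (n : nat) (U : 'I_n -> {vspace V}),
    [/\ forall i, simple_submodule act (U i),
        directv (\sum_i U i)
      & (\sum_i U i)%VS = fullv].

Definition semisimple_algebra (K : fieldType) (A : vectType K)
    (mul : A -> A -> A) (one : A) : Prop :=
  forall (V : vectType K) (act : A -> V -> V),
    is_amodule mul one act -> semisimple_module act.

Definition tmul (K : fieldType) (H : falgType K) (s t : tens H H) : tens H H :=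
  \tsum_(a, b <- s) \tsum_(c, d <- t) ((a * c) ⊗ (b * d)).

Definition tflip (K : fieldType) (V W : vectType K) (t : tens V W) : tens W V :=
  \tsum_(a, b <- t) (b ⊗ a).

Record hopf (K : fieldType) (H : falgType K) := Hopf {
  Delta : 'Hom(H, tens H H);
  eps : 'Hom(H, K^o);
  Sant : 'End(H);
  Delta1 : Delta 1 = 1 ⊗ 1;
  DeltaM : forall x y, Delta (x * y) = tmul (Delta x) (Delta y);
  eps1 : eps 1 = 1;
  epsM : forall x y, eps (x * y) = eps x * eps y;
  coassoc : forall x,
    \tsum_(a, b <- Delta x) \tsum_(a1, a2 <- Delta a) (a1 ⊗ (a2 ⊗ b)) =
    \tsum_(a, b <- Delta x) \tsum_(b1, b2 <- Delta b) (a ⊗ (b1 ⊗ b2));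
  counitl : forall x, \tsum_(a, b <- Delta x) (eps a *: b) = x;
  counitr : forall x, \tsum_(a, b <- Delta x) (eps b *: a) = x;
  antipodel : forall x, \tsum_(a, b <- Delta x) (Sant a * b) = eps x *: 1;
  antipoder : forall x, \tsum_(a, b <- Delta x) (a * Sant b) = eps x *: 1
}.

(** [Rmat] is R = R' ⊗ R'', [Rinv] its inverse in H ⊗ H; [drinfeld] is the
    Drinfeld element u = S(R'') R'; the ribbon element v is normalised by
    Δ(v) = (R_21 R)^-1 (v ⊗ v), so that the twist of a module is the action of
    v^-1 and the pivotal element is u v^-1. *)
Record ribbon_hopf (K : fieldType) (H : falgType K) := RibbonHopf {
  rhopf :> hopf H;
  Rmat : tens H H;
  Rinv : tens H H;
  RmatV : tmul Rmat Rinv = 1 ⊗ 1;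
  RinvM : tmul Rinv Rmat = 1 ⊗ 1;
  Rmat_Delta : forall x,
    tmul Rmat (Delta rhopf x) = tmul (tflip (Delta rhopf x)) Rmat;
  Delta_id_R :
    \tsum_(a, b <- Rmat) \tsum_(a1, a2 <- Delta rhopf a) (a1 ⊗ (a2 ⊗ b)) =
    \tsum_(a, b <- Rmat) \tsum_(c, d <- Rmat) (a ⊗ (c ⊗ (b * d)));
  id_Delta_R :
    \tsum_(a, b <- Rmat) \tsum_(b1, b2 <- Delta rhopf b) (a ⊗ (b1 ⊗ b2)) =
    \tsum_(a, b <- Rmat) \tsum_(c, d <- Rmat) ((a * c) ⊗ (d ⊗ b));
  drinfeld : H := \tsum_(a, b <- Rmat) (Sant rhopf b * a);
  ribbon : H;
  ribbon_unit : ribbon \is a GRing.unit;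
  ribbon_central : forall x, ribbon * x = x * ribbon;
  ribbon_sqr : ribbon ^+ 2 = drinfeld * Sant rhopf drinfeld;
  ribbon_S : Sant rhopf ribbon = ribbon;
  ribbon_eps : eps rhopf ribbon = 1;
  ribbon_Delta :
    tmul (tmul (tflip Rmat) Rmat) (Delta rhopf ribbon) = ribbon ⊗ ribbon
}.

Definition pivotal (K : fieldType) (H : falgType K) (A : ribbon_hopf H) : H :=
  drinfeld A * (ribbon A)^-1.

Definition left_integral (K : fieldType) (H : falgType K) (A : hopf H)
    (lam : 'Hom(H, K^o)) : Prop :=
  forall x, \tsum_(a, b <- Delta A x) (lam b *: a) = lam x *: 1.

Definition left_cointegral (K : fieldType) (H : falgType K) (A : hopf H)
    (L : H) : Prop :=
  forall x, x * L = eps A x *: L.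

Definition two_sided_cointegral (K : fieldType) (H : falgType K) (A : hopf H)
    (L : H) : Prop :=
  left_cointegral A L /\ forall x, L * x = eps A x *: L.

Definition unimodular (K : fieldType) (H : falgType K) (A : hopf H) : Prop :=
  forall L : H, left_cointegral A L -> Sant A L = L.

Definition semisimple (K : fieldType) (H : falgType K) : Prop :=
  semisimple_algebra (fun x y : H => x * y) 1.

Definition conv (K : fieldType) (H : falgType K) (A : hopf H)
    (f g : 'Hom(H, K^o)) : 'Hom(H, K^o) :=
  linfun (fun x : H => \tsum_(a, b <- Delta A x) (f a * g b : K^o)).

Definition cosemisimple (K : fieldType) (H : falgType K) (A : hopf H) : Prop :=
  semisimple_algebra (conv A) (eps A).

(** [hrep] is the raw data of an action; [hmodule] says that it is a module.
    Colours of tangles are always assumed to satisfy [hmodule]; the derived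
    actions ([triv], [dual], [tensrep], [adrep]) then satisfy it as well. *)

Record hrep (K : fieldType) (H : falgType K) := HRep {
  hsort :> vectType K;
  hact : H -> hsort -> hsort
}.

Definition hmodule (K : fieldType) (H : falgType K) (V : hrep H) : Prop :=
  is_amodule (fun x y : H => x * y) 1 (@hact K H V).

Definition triv (K : fieldType) (H : falgType K) (A : hopf H) : hrep H :=
  @HRep K H K^o (fun h (c : K^o) => eps A h *: c).

Definition dual (K : fieldType) (H : falgType K) (A : hopf H) (V : hrep H) :
    hrep H :=
  @HRep K H 'Hom(V, K^o)
    (fun h f => linfun (fun v : V => f (hact (Sant A h) v))).

Definition tensrep (K : fieldType) (H : falgType K) (A : hopf H)
    (V W : hrep H) : hrep H :=
  @HRep K H (tens V W)
    (fun h t => \tsum_(a, b <- Delta A h) \tsum_(v, w <- t)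
                  (hact a v ⊗ hact b w)).

Definition adrep (K : fieldType) (H : falgType K) (A : hopf H) : hrep H :=
  @HRep K H H (fun h x => \tsum_(a, b <- Delta A h) (a * x * Sant A b)).

Definition intertwiner (K : fieldType) (H : falgType K) (V W : hrep H)
    (f : 'Hom(V, W)) : Prop :=
  forall (h : H) (v : V), f (hact h v) = hact h (f v).

(** The structure morphism j_V : ad -> V ⊗ V^* of the end. *)
Definition jmap (K : fieldType) (H : falgType K) (A : hopf H) (V : hrep H)
    (x : H) : tens V (dual A V) :=
  \sum_i (hact x (basis_vec i) ⊗ dual_basis_vec i).

Fixpoint adpow (K : fieldType) (H : falgType K) (A : hopf H) (n : nat) : hrep H :=
  if n is n'.+1 then tensrep A (adrep A) (adpow A n') else triv A.

Fixpoint lam_pow (K : fieldType) (H : falgType K) (A : hopf H)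
    (lam : 'Hom(H, K^o)) (n : nat) : adpow A n -> K^o :=
  match n return adpow A n -> K^o with
  | 0 => id
  | n'.+1 => fun t => \tsum_(x, r <- t) (lam x * lam_pow lam r : K^o)
  end.

Fixpoint Lam_pow (K : fieldType) (H : falgType K) (A : hopf H) (L : H)
    (n : nat) : adpow A n :=
  match n return adpow A n with
  | 0 => 1 : K^o
  | n'.+1 => L ⊗ Lam_pow A L n'
  end.

(** * Coloured framed tangle diagrams

    A letter (true, s) is an upward strand coloured by X_s, i.e. the object
    X_s; (false, s) is a downward one, i.e. the object X_s^*.  Diagrams are
    read from the bottom word to the top word and carry the blackboard
    framing. *)

Definition letter : Type := bool * nat.
Definition word : Type := seq letter.

Definition lopp (l : letter) : letter := (~~ l.1, l.2).

(** The dual word: letters are reversed in order and in orientation. *)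
Fixpoint wdual (w : word) : word :=
  if w is l :: w' then wdual w' ++ [:: lopp l] else [::].

(** One elementary generator with parallel strands on both sides.  In
    [CrossP] the strand starting at the bottom left is the over-strand for the
    braiding x ⊗ y |-> R'' y ⊗ R' x; [CrossN] is the inverse crossing. *)
Inductive slice : word -> word -> Type :=
| Strand l w w' : slice w w' -> slice (l :: w) (l :: w')
| Cup l w : slice w (l :: lopp l :: w)
| Cap l w : slice (l :: lopp l :: w) w
| CrossP l m w : slice (l :: m :: w) (m :: l :: w)
| CrossN l m w : slice (l :: m :: w) (m :: l :: w).

Inductive tangle : word -> word -> Type :=
| Straight w : tangle w w
| Stack w w' w'' : slice w w' -> tangle w' w'' -> tangle w w''.

Definition lmod (K : fieldType) (H : falgType K) (A : hopf H)
    (X : nat -> hrep H) (l : letter) : hrep H :=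
  match l with
  | (true, s) => X s
  | (false, s) => dual A (X s)
  end.

Fixpoint wmod (K : fieldType) (H : falgType K) (A : hopf H)
    (X : nat -> hrep H) (w : word) : hrep H :=
  if w is l :: w' then tensrep A (lmod A X l) (wmod A X w') else triv A.

(** The isomorphism from the dual of the object of a letter to the object of
    the opposite letter; for a downward strand it is the inverse
    X^** -> X of the pivotal isomorphism v |-> (f |-> f (g v)). *)
Definition ldual (K : fieldType) (H : falgType K) (A : ribbon_hopf H)
    (X : nat -> hrep H) (l : letter) :
    dual A (lmod A X l) -> lmod A X (lopp l) :=
  match l return dual A (lmod A X l) -> lmod A X (lopp l) with
  | (true, s) => id
  | (false, s) => fun xi =>
      \sum_i xi (dual_basis_vec i) *: hact (pivotal A)^-1 (basis_vec i)
  end.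

Definition cup_vec (K : fieldType) (H : falgType K) (A : ribbon_hopf H)
    (X : nat -> hrep H) (l : letter) :
    tens (lmod A X l) (lmod A X (lopp l)) :=
  \sum_i (basis_vec i ⊗ ldual (dual_basis_vec i)).

Definition cap_form (K : fieldType) (H : falgType K) (A : ribbon_hopf H)
    (X : nat -> hrep H) (l : letter) :
    lmod A X l -> lmod A X (lopp l) -> K :=
  match l return lmod A X l -> lmod A X (lopp l) -> K with
  | (true, s) => fun v f => f (hact (pivotal A) v)
  | (false, s) => fun f v => f v
  end.

Fixpoint rt_slice (K : fieldType) (H : falgType K) (A : ribbon_hopf H)
    (X : nat -> hrep H) (w w' : word) (s : slice w w') :
    wmod A X w -> wmod A X w' :=
  match s in slice w w' return wmod A X w -> wmod A X w' with
  | Strand l w w' s' => fun t => \tsum_(x, r <- t) (x ⊗ rt_slice s' r)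
  | Cup l w => fun r => \tsum_(x, y <- cup_vec A X l) (x ⊗ (y ⊗ r))
  | Cap l w => fun t =>
      \tsum_(x, t' <- t) \tsum_(y, r <- t') (cap_form x y *: r)
  | CrossP l m w => fun t =>
      \tsum_(x, t' <- t) \tsum_(y, r <- t') \tsum_(a, b <- Rmat A)
        (hact b y ⊗ (hact a x ⊗ r))
  | CrossN l m w => fun t =>
      \tsum_(x, t' <- t) \tsum_(y, r <- t') \tsum_(a, b <- Rinv A)
        (hact a y ⊗ (hact b x ⊗ r))
  end.

Fixpoint rt_tangle (K : fieldType) (H : falgType K) (A : ribbon_hopf H)
    (X : nat -> hrep H) (w w' : word) (T : tangle w w') :
    wmod A X w -> wmod A X w' :=
  match T in tangle w w' return wmod A X w -> wmod A X w' with
  | Straight w => id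
  | Stack w w' w'' s T' => fun t => rt_tangle T' (rt_slice s t)
  end.

(** The canonical isomorphism V_w ⊗ V_w' -> V_{w ++ w'}. *)
Fixpoint wcat (K : fieldType) (H : falgType K) (A : hopf H)
    (X : nat -> hrep H) (w w' : word) :
    wmod A X w -> wmod A X w' -> wmod A X (w ++ w') :=
  match w return wmod A X w -> wmod A X w' -> wmod A X (w ++ w') with
  | [::] => fun c t => (c : K^o) *: t
  | l :: w1 => fun t t' => \tsum_(x, r <- t) (x ⊗ wcat r t')
  end.

(** The canonical isomorphism (V_w)^* -> V_{wdual w}, which turns the
    coevaluation of V_w into nested cups. *)
Fixpoint wdual_iso (K : fieldType) (H : falgType K) (A : ribbon_hopf H)
    (X : nat -> hrep H) (w : word) :
    dual A (wmod A X w) -> wmod A X (wdual w) :=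
  match w return dual A (wmod A X w) -> wmod A X (wdual w) with
  | [::] => fun phi => phi (1 : K^o)
  | l :: w1 => fun phi =>
      \sum_i wcat
        (wdual_iso
          (linfun (fun r : wmod A X w1 => phi (basis_vec i ⊗ r))
             : dual A (wmod A X w1)))
        (ldual (dual_basis_vec i) ⊗ (1 : K^o) : wmod A X [:: lopp l])
  end.

(** [bottom_line [:: w_1; ...; w_d]] is the bottom line
    w_1 w_1^* ... w_d w_d^*, and [top_line [:: s_1; ...; s_k]] is the top line
    X_{s_1} X_{s_1}^* ... X_{s_k} X_{s_k}^*. *)
Definition bottom_line (ws : seq word) : word :=
  foldr (fun w acc => w ++ (wdual w ++ acc)) [::] ws.

Definition top_line (cs : seq nat) : word :=
  foldr (fun s acc => (true, s) :: (false, s) :: acc) [::] cs.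

Fixpoint j_bottom (K : fieldType) (H : falgType K) (A : ribbon_hopf H)
    (X : nat -> hrep H) (ws : seq word) :
    adpow A (size ws) -> wmod A X (bottom_line ws) :=
  match ws return adpow A (size ws) -> wmod A X (bottom_line ws) with
  | [::] => id
  | w :: ws' => fun t =>
      \tsum_(x, r <- t) \tsum_(y, phi <- jmap A (wmod A X w) x)
        wcat y (wcat (wdual_iso phi) (j_bottom X r))
  end.

Fixpoint j_top (K : fieldType) (H : falgType K) (A : ribbon_hopf H)
    (X : nat -> hrep H) (cs : seq nat) :
    adpow A (size cs) -> wmod A X (top_line cs) :=
  match cs return adpow A (size cs) -> wmod A X (top_line cs) with
  | [::] => id
  | s :: cs' => fun t =>
      \tsum_(x, r <- t) \tsum_(y, phi <- jmap A (X s) x)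
        (y ⊗ (phi ⊗ j_top X r))
  end.

(** * Kirby links, cut open

    A Kirby link with d dotted and k undotted components is given by the
    tangle diagram obtained by opening up the Seifert discs of the dotted
    components and cutting each undotted component once.  [kdiscs] lists, for
    each dotted component, the word w_i of the strands crossing its disc, so
    that the i-th bottom block is w_i (w_i)^*; gluing the two halves of the
    blocks by nested pairing and closing the top arcs gives back the link.
    [kcut] says that every undotted component has been cut, i.e. that no
    component of the tangle with the bottom blocks so joined is closed.
    Since the colour of a strand is constant and the k colours at the top are
    distinct, there are then exactly k arcs, the s-th one joining the
    endpoints X_s and X_s^* at the top. *)

(** Endpoints of the part of the diagram below a given level are labelled by
    the component (of that part) to which they belong.  [slice_labels s n lab]
    gives the labels above [s], with [n] the label of a new component, and the
    labels of the two endpoints joined by a cap, if any. *)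
Fixpoint slice_labels (w w' : word) (s : slice w w') (n : nat) (lab : seq nat) :
    seq nat * option (nat * nat) :=
  match s with
  | Strand _ _ _ s' =>
      let: (r, m) := slice_labels s' n (behead lab) in (head 0%N lab :: r, m)
  | Cup _ _ => (n :: n :: lab, None)
  | Cap _ _ => (drop 2 lab, Some (nth 0%N lab 0, nth 0%N lab 1))
  | CrossP _ _ _ | CrossN _ _ _ =>
      (nth 0%N lab 1 :: nth 0%N lab 0 :: drop 2 lab, None)
  end.

Definition fresh_label (lab : seq nat) : nat := (foldr maxn 0 lab).+1.

Fixpoint no_closed (w w' : word) (T : tangle w w') (lab : seq nat) : bool :=
  match T with
  | Straight _ => true
  | Stack _ _ _ s T' =>
      let: (lab', m) := slice_labels s (fresh_label lab) lab in
      if m is Some (a, b) then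
        (a != b) && no_closed T' [seq (if c == b then a else c) | c <- lab']
      else no_closed T' lab'
  end.

Fixpoint bottom_labels (n : nat) (ws : seq word) : seq nat :=
  if ws is w :: ws' then
    let l := iota n (size w) in l ++ rev l ++ bottom_labels (n + size w) ws'
  else [::].

Record kirby := Kirby {
  kdiscs : seq word;
  kcomps : nat;
  ktangle : tangle (bottom_line kdiscs) (top_line (iota 0 kcomps));
  kcut : no_closed ktangle (bottom_labels 0 kdiscs)
}.

(** One undotted 0-framed unknot, cut open to a single arc. *)
Definition S2xD2 : kirby :=
  @Kirby [::] 1 (Stack (Cup (true, 0%N) [::]) (Straight _)) isT.

(** One dotted unknot whose disc is crossed by no strand. *)
Definition S1xD3 : kirby :=
  @Kirby [:: [::]] 0 (Straight [::]) isT.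

(** The characterisation of the intertwiner Φ of a cut-open Kirby link: it is
    determined by the equation, tested on all colourings by modules. *)
Definition is_Phi (K : fieldType) (H : falgType K) (A : ribbon_hopf H)
    (D : kirby)
    (Phi : 'Hom(adpow A (size (kdiscs D)), adpow A (size (iota 0 (kcomps D))))) :
    Prop :=
  intertwiner Phi /\
  forall X : nat -> hrep H, (forall s, hmodule (X s)) ->
  forall t, rt_tangle (ktangle D) (j_bottom X t) = j_top X (Phi t).

Definition J4_Phi (K : fieldType) (H : falgType K) (A : ribbon_hopf H)
    (D : kirby) :
    'Hom(adpow A (size (kdiscs D)), adpow A (size (iota 0 (kcomps D)))) :=
  xget 0 [set Phi | @is_Phi K H A D Phi]%classic.

(** The endomorphism λ^{⊗k} ∘ Φ ∘ Λ^{⊗d} of the trivial module, as a scalar. *)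
Definition J4 (K : fieldType) (H : falgType K) (A : ribbon_hopf H)
    (lam : 'Hom(H, K^o)) (L : H) (D : kirby) : K :=
  lam_pow lam (J4_Phi A D (Lam_pow A L (size (kdiscs D)))).

(* Main.v *)
(** The two values come from the explicit intertwiners Φ = (t ↦ 1 ⊗ t) for
    S²×D² and Φ = ε ⊗ id for S¹×D³; Φ is determined by its defining equation on
    the regular representation, where j_H is injective.

    The criteria are Maschke's theorem for H and for H*.  The separability
    element is Λ_1 ⊗ S(Λ_2) for H, with product ε(Λ), and the one representing
    the bilinear form λ(x S(y)) for H*, with product λ(1) ε.  Conversely, a
    simple summand of the regular module outside the kernel of the counit is
    spanned by a vector u on which the algebra acts through the counit.  For H,
    computing Λ u in two ways gives ε(Λ) u = ε(u) Λ; for H*, computing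
    (λ ∘ S) * u in two ways gives λ(1) u = u(1) (λ ∘ S), where
    λ(S(Λ)) = λ(Λ) = 1 by unimodularity. *)
From HB Require Import structures.
Require Import Defs.
From mathcomp Require Import all_boot all_order all_algebra all_field.
From mathcomp Require Import boolp classical_sets.

Set Implicit Arguments.
Unset Strict Implicit.
Unset Printing Implicit Defensive.

Import GRing.Theory.
Local Open Scope ring_scope.

(** * Linearity and bilinearity of plain functions *)

Definition islin (K : fieldType) (V W : vectType K) (f : V -> W) : Prop :=
  forall (c : K) (u v : V), f (c *: u + v) = c *: f u + f v.

Definition bilin (K : fieldType) (V W U : vectType K) (B : V -> W -> U) : Prop :=
  (forall w, islin (fun v => B v w)) /\ (forall v, islin (B v)).

Section Linear.
Variables (K : fieldType) (V W U : vectType K).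
Implicit Types (f : V -> W).

Lemma islinD f : islin f -> forall u v, f (u + v) = f u + f v.
Proof. by move=> fL u v; rewrite -{1}[u]scale1r fL scale1r. Qed.

Lemma islin0 f : islin f -> f 0 = 0.
Proof. by move=> /islinD fD; apply: (addrI (f 0)); rewrite -fD !addr0. Qed.

Lemma islinZ f : islin f -> forall c u, f (c *: u) = c *: f u.
Proof. by move=> fL c u; rewrite -[c *: u]addr0 fL (islin0 fL) addr0. Qed.

Lemma islin_sum f : islin f -> forall (I : Type) (r : seq I) (P : pred I) F,
  f (\sum_(i <- r | P i) F i) = \sum_(i <- r | P i) f (F i).
Proof. by move=> fL I r P F; apply: big_morph; [exact: islinD | exact: islin0]. Qed.

Lemma linfunE f : islin f -> linfun f =1 f.
Proof.
move=> fL v.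
pose F : {linear V -> W} := HB.pack f (GRing.isLinear.Build K V W _ f fL).
by rewrite (lfunE F).
Qed.

Lemma islin_id : islin (fun x : V => x). Proof. by []. Qed.

Lemma islin_hom (f : 'Hom(W, U)) (g : V -> W) :
  islin g -> islin (fun x => f (g x)).
Proof. by move=> gL c u v; rewrite gL linearP. Qed.

Lemma islin_eval (g : V -> 'Hom(W, U)) (w : W) :
  islin g -> islin (fun x => g x w).
Proof. by move=> gL c u v; rewrite gL add_lfunE scale_lfunE. Qed.

Lemma islin_scalel (g : V -> K^o) (w : W) :
  islin g -> islin (fun x => g x *: w).
Proof. by move=> gL c u v; rewrite gL scalerDl scalerA. Qed.

Lemma islin_scaler (g : V -> W) (a : K) :
  islin g -> islin (fun x => a *: g x).
Proof. by move=> gL c u v; rewrite gL scalerDr !scalerA mulrC. Qed.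

Lemma islin_sumr (I : Type) (r : seq I) (P : pred I) (g : I -> V -> W) :
  (forall i, islin (g i)) -> islin (fun x => \sum_(i <- r | P i) g i x).
Proof.
move=> gL c u v; rewrite scaler_sumr -big_split /=.
by apply: eq_bigr => i _; rewrite gL.
Qed.

Lemma islin_tpurel (g : V -> W) (u : U) : islin g -> islin (fun x => g x ⊗ u).
Proof.
by move=> gL c x y; apply/matrixP=> i j; rewrite !mxE gL linearP mulrDl mulrA.
Qed.

Lemma islin_tpurer (g : V -> W) (u : U) : islin g -> islin (fun x => u ⊗ g x).
Proof.
move=> gL c x y; apply/matrixP=> i j.
by rewrite !mxE gL linearP mulrDr mulrCA.
Qed.

End Linear.

Lemma islin_mull (K : fieldType) (V : vectType K) (H : falgType K)
  (g : V -> H) (a : H) : islin g -> islin (fun x => g x * a).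
Proof. by move=> gL c u v; rewrite gL mulrDl scalerAl. Qed.

Lemma islin_mulr (K : fieldType) (V : vectType K) (H : falgType K)
  (g : V -> H) (a : H) : islin g -> islin (fun x => a * g x).
Proof. by move=> gL c u v; rewrite gL mulrDr scalerAr. Qed.

Lemma islin_tlift (K : fieldType) (V1 V2 V W : vectType K)
  (B : V1 -> V2 -> W) (g : V -> tens V1 V2) :
  islin g -> islin (fun x => tlift B (g x)).
Proof.
move=> gL c u v; rewrite /tlift gL scaler_sumr -big_split /=.
apply: eq_bigr => i _; rewrite scaler_sumr -big_split /=.
by apply: eq_bigr => j _; rewrite !mxE scalerDl scalerA.
Qed.

Lemma islin_tlift_body (K : fieldType) (V1 V2 V W : vectType K)
  (B : V -> V1 -> V2 -> W) (t : tens V1 V2) :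
  (forall a b, islin (fun x => B x a b)) -> islin (fun x => tlift (B x) t).
Proof.
move=> BL; rewrite /tlift; apply: islin_sumr => i; apply: islin_sumr => j.
exact: islin_scaler.
Qed.

(** Sweedler integrands are anonymous functions, so linearity is a predicate on bare functions,
    proved by descending through the integrand to the place where the variable occurs. *)
Ltac lin_step :=
  cbv beta;
  first
  [ assumption
  | exact: islin_id
  | apply: islin_tlift_body => ? ?
  | apply: islin_tlift
  | apply: islin_tpurel
  | apply: islin_tpurer
  | apply: islin_hom
  | apply: islin_eval
  | apply: islin_scaler
  | apply: islin_scalel
  | apply: islin_mull
  | apply: islin_mulr
  | apply: islin_sumr => ? ].
Ltac lin := repeat lin_step.
Ltac bilin := split=> ?; lin.

(** * Calculus of tensors in Sweedler notation *)

Section Tensor.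
Variables (K : fieldType).
Implicit Types (V W U : vectType K).

Lemma basis_vecE V (v : V) : \sum_i coord (vbasis {:V}) i v *: basis_vec i = v.
Proof. by rewrite -coord_vbasis ?memvf. Qed.

Lemma coord_basis_vec V i j : coord (vbasis {:V}) i (basis_vec j) = (j == i)%:R.
Proof. by rewrite /basis_vec coord_free // (basis_free (vbasisP _)). Qed.

(** The universal property of the tensor product: expanding both vectors in the chosen bases shows
    that the coordinate formula for [tlift] is independent of these bases on bilinear integrands. *)
Lemma tlift_pure V W U (B : V -> W -> U) v w : bilin B -> tlift B (v ⊗ w) = B v w.
Proof.
case=> Bl Br; rewrite -[in RHS](basis_vecE v) -[in RHS](basis_vecE w).
rewrite (islin_sum (Bl _)); apply: eq_bigr => i _.
rewrite (islinZ (Bl _)) (islin_sum (Br _)) scaler_sumr.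
by apply: eq_bigr => j _; rewrite (islinZ (Br _)) scalerA mxE.
Qed.

Lemma tlift_id V W (t : tens V W) : \tsum_(a, b <- t) (a ⊗ b) = t.
Proof.
apply/matrixP=> k l; rewrite /tlift summxE (bigD1 k) //= summxE (bigD1 l) //=.
rewrite !mxE !coord_basis_vec !eqxx !mulr1 !big1 ?addr0 // => [i ik | j jl].
  rewrite summxE big1 // => j _.
  by rewrite !mxE !coord_basis_vec (negPf ik) mul0r mulr0.
by rewrite !mxE !coord_basis_vec (negPf jl) !mulr0.
Qed.

Lemma eq_tlift V W U (B B' : V -> W -> U) t :
  (forall a b, B a b = B' a b) -> tlift B t = tlift B' t.
Proof. by move=> eqB; apply: eq_bigr=> i _; apply: eq_bigr=> j _; rewrite eqB. Qed.

Lemma tlift_lin V W U U' (f : U -> U') (B : V -> W -> U) t :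
  islin f -> f (tlift B t) = \tsum_(a, b <- t) f (B a b).
Proof.
move=> fL; rewrite /tlift (islin_sum fL); apply: eq_bigr => i _.
by rewrite (islin_sum fL); apply: eq_bigr => j _; rewrite (islinZ fL).
Qed.

Lemma tlift_exchange V W V' W' U (F : V -> W -> V' -> W' -> U) t t' :
  \tsum_(a, b <- t) \tsum_(c, d <- t') F a b c d =
  \tsum_(c, d <- t') \tsum_(a, b <- t) F a b c d.
Proof.
rewrite /tlift; under eq_bigr => i _ do under eq_bigr => j _ do rewrite scaler_sumr.
under eq_bigr => i _ do rewrite exchange_big.
rewrite exchange_big; apply: eq_bigr => k _.
under eq_bigr => i _ do under eq_bigr => j _ do rewrite scaler_sumr.
under eq_bigr => i _ do rewrite exchange_big.
rewrite exchange_big; apply: eq_bigr => l _.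
rewrite scaler_sumr; apply: eq_bigr => i _; rewrite scaler_sumr.
by apply: eq_bigr => j _; rewrite !scalerA mulrC.
Qed.

Lemma tliftZ V W U (B : V -> W -> U) c t : tlift B (c *: t) = c *: tlift B t.
Proof. by apply: (islinZ (f := tlift B)); lin. Qed.

Lemma tlift_tlift V W V' W' U (B : V' -> W' -> U) (F : V -> W -> tens V' W') t :
  tlift B (tlift F t) = \tsum_(a, b <- t) tlift B (F a b).
Proof. by apply: (tlift_lin (f := tlift B)); lin. Qed.

Lemma tlift_sum_body V W U (I : finType) (F : I -> V -> W -> U) t :
  \tsum_(a, b <- t) \sum_i F i a b = \sum_i \tsum_(a, b <- t) F i a b.
Proof.
rewrite /tlift; under eq_bigr => k _ do under eq_bigr => l _ do rewrite scaler_sumr.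
by under eq_bigr => k _ do rewrite exchange_big; rewrite exchange_big.
Qed.

Lemma tlift_sum V W U (B : V -> W -> U) (I : finType) (F : I -> tens V W) :
  tlift B (\sum_i F i) = \sum_i tlift B (F i).
Proof. by apply: (islin_sum (f := tlift B)); lin. Qed.

Lemma dual_basis_vecE V i (v : V) : dual_basis_vec i v = coord (vbasis {:V}) i v.
Proof. by rewrite linfunE // => c u w; rewrite linearP. Qed.

Lemma dual_basis_expansion V U (f : V -> U) (v : V) : islin f ->
  \sum_i dual_basis_vec i v *: f (basis_vec i) = f v.
Proof.
move=> fL; rewrite -[in RHS](basis_vecE v) (islin_sum fL).
by apply: eq_bigr => i _; rewrite (islinZ fL) dual_basis_vecE.
Qed.

Lemma lfun_dual_basis V (f : 'Hom(V, K^o)) :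
  \sum_i f (basis_vec i) *: dual_basis_vec i = f.
Proof.
apply/lfunP => v; rewrite sum_lfunE -[in RHS](dual_basis_expansion (f := f)) //; last first.
  by move=> c x y; rewrite linearP.
by apply: eq_bigr => i _; rewrite scale_lfunE; exact: mulrC.
Qed.

End Tensor.

(** * Semisimplicity from stable complements *)

Section Modules.
Variables (K : fieldType) (A V : vectType K) (act : A -> V -> V).

(** Induction on dimension: either [U] is minimal, or it contains a smaller nonzero stable
    subspace. *)
Lemma simple_submodule_exists (U : {vspace V}) :
  U <> 0%VS -> stable_subspace act U ->
  exists2 W, (W <= U)%VS & simple_submodule act W.
Proof.
have [d] := ubnP (\dim U); elim: d U => // d IHd U; rewrite ltnS => dimU U0 sU.
have [[W [WU sW W0 neqWU]]|minU] :=
  EM (exists W, [/\ (W <= U)%VS, stable_subspace act W, W <> 0%VS & W <> U]).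
  have ltW : (\dim W < d)%N.
    apply: leq_trans dimU; rewrite ltn_neqAle dimvS // andbT.
    by apply/eqP => eqd; apply/neqWU/eqP; rewrite eqEdim WU eqd /=.
  have [W' W'W simW'] := IHd W ltW W0 sW.
  by exists W' => //; apply: subv_trans WU.
exists U => //; split=> // W WU sW.
have [->|neqW0] := EM (W = 0%VS); first by left.
by right; apply: contrapT => neqWU; apply: minU; exists W.
Qed.

(** A simple [W] is split off from [U] repeatedly; if [W'] complements [W] in the whole space, then
    U ∩ W' complements [W] in [U] by the modular law, and its dimension is smaller. *)
Lemma complemented_semisimple :
  (forall W : {vspace V}, stable_subspace act W -> exists W' : {vspace V},
    [/\ stable_subspace act W', (W :&: W' = 0)%VS & (W + W' = fullv)%VS]) ->
  semisimple_module act.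
Proof.
move=> compl.
suff decU d (U : {vspace V}) : (\dim U < d)%N -> stable_subspace act U ->
    exists (n : nat) (F : 'I_n -> {vspace V}),
    [/\ forall i, simple_submodule act (F i), directv (\sum_i F i)
      & (\sum_i F i)%VS = U].
  by apply: (decU _ fullv (ltnSn _)) => a v _; rewrite memvf.
elim: d U => // d IHd U; rewrite ltnS => dimU sU.
have [U0|U0] := EM (U = 0%VS).
  exists 0, (fun=> 0%VS); split=> [[]//||]; last by rewrite big_ord0 U0.
  by rewrite directvE /= !big_ord0 dimv0.
have [W WU simW] := simple_submodule_exists U0 sU.
have [W0 sW _] := simW; have [W' [sW' WW'0 WW'1]] := compl W sW.
have WT0 : (W :&: (U :&: W') = 0)%VS by rewrite capvA (capvC W) -capvA WW'0 capv0.
have WT1 : (W + (U :&: W') = U)%VS by rewrite (capvC U) vspace_modl // WW'1 capfv.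
have dimUE : (\dim U = \dim W + \dim (U :&: W'))%N.
  by rewrite -[in LHS]WT1 dimv_disjoint_sum.
have dT : (\dim (U :&: W') < d)%N.
  apply: leq_trans dimU; rewrite dimUE -[X in (X < _)%N]add0n ltn_add2r.
  by rewrite lt0n dimv_eq0; apply/eqP.
have sT : stable_subspace act (U :&: W')%VS.
  by move=> a v; rewrite !memv_cap => /andP[/sU-> /sW'->].
have [n [F [simF dirF sumF]]] := IHd _ dT sT.
exists n.+1, (fun i => oapp F W (unlift ord0 i)).
have sumE : (\sum_(i < n.+1) oapp F W (unlift ord0 i) = U)%VS.
  rewrite big_ord_recl unlift_none /= -[RHS]WT1 -sumF; congr addv.
  by apply: eq_bigr => i _; rewrite liftK.
split=> //.
  by move=> i; case: unliftP => [j|] _ /=; [exact: simF | exact: simW].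
(* Directness is checked by adding up dimensions. *)
rewrite directvE /= sumE big_ord_recl unlift_none /= dimUE eqn_add2l.
rewrite -sumF; move: dirF; rewrite directvE /= => /eqP->; apply/eqP.
by apply: eq_bigr => i _; rewrite liftK.
Qed.

End Modules.

(** * Separability elements and characters *)

Section Algebras.
Variables (K : fieldType) (A : vectType K) (mul : A -> A -> A) (one : A).

(* Maschke: e turns a linear projection onto a submodule into an equivariant
   one, v |-> e' p(e'' v). *)
Lemma separable_semisimple (e : tens A A) :
  (forall a, \tsum_(x, y <- e) (mul a x ⊗ y) = \tsum_(x, y <- e) (x ⊗ mul y a)) ->
  \tsum_(x, y <- e) mul x y = one ->
  semisimple_algebra mul one.
Proof.
move=> eC e1 V act [actDl actDr act1 actM].
apply: complemented_semisimple => W sW.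
have actl v : islin (act^~ v) by move=> c a b; rewrite actDl.
have actr a : islin (act a) by move=> c v w; rewrite actDr.
have bilE v : bilin (fun x y => act x (projv W (act y v))).
  split=> [y|x]; first exact: actl.
  move=> c y z; rewrite -actr; congr act.
  by rewrite actl linearP.
have [P PE] : exists P : 'End(V),
    forall v, P v = \tsum_(x, y <- e) act x (projv W (act y v)).
  eexists (linfun _) => v; rewrite linfunE; first by [].
  apply: islin_tlift_body => x y c v1 v2.
  by rewrite actr linearP actr.
have PW v : P v \in W.
  rewrite PE /tlift; apply: memv_suml => i _; apply: memv_suml => j _.
  by rewrite memvZ // sW // memv_proj.
have PE1 w : w \in W -> P w = w.
  move=> Ww; rewrite PE -[RHS]act1 -e1 (tlift_lin (f := act^~ w)) //.
  by apply: eq_tlift => x y; rewrite projv_id ?sW // actM.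
have PA a v : P (act a v) = act a (P v).
  (* Applied to [eC], this bilinear map turns e' p(e'' a v) into a e' p(e'' v). *)
  pose B x y := act x (projv W (act y v)).
  rewrite !PE (tlift_lin (f := act a)) //.
  have := congr1 (tlift B) (eC a); rewrite !tlift_tlift /B.
  under eq_tlift => x y do rewrite (tlift_pure _ _ (bilE v)) actM.
  move=> ->.
  by apply: eq_tlift => x y; rewrite (tlift_pure _ _ (bilE v)) actM.
exists (lker P); split.
- by move=> a v; rewrite !memv_ker PA => /eqP->; rewrite (islin0 (actr a)).
- apply/eqP; rewrite -subv0; apply/subvP => v; rewrite memv_cap => /andP[Wv].
  by rewrite memv_ker PE1 // memv0.
- apply/eqP; rewrite eqEsubv subvf; apply/subvP => v _.
  rewrite -[v](subrKC (P v)); apply: memv_add => //.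
  by rewrite memv_ker linearB /= (PE1 (P v)) ?subrr.
Qed.

(** Some simple summand U_i is not contained in ker χ. Since ker χ is a submodule, it meets U_i in
    zero, and for u in U_i the vector a u - χ(a) u lies in both. *)
Lemma semisimple_character_eigenvector (chi : 'Hom(A, K^o)) :
  is_amodule mul one mul -> (forall a b, chi (mul a b) = chi a * chi b) ->
  chi one = 1 -> semisimple_algebra mul one ->
  exists u, (forall a, mul a u = chi a *: u) /\ chi u <> 0.
Proof.
move=> modA chiM chi1 /(_ A mul modA)[n [U [simU _ sumU]]].
have [i /subvPn[u Uu ku]] : exists i, ~~ (U i <= lker chi)%VS.
  apply: contrapT => /forallNP kU.
  have : (fullv <= lker chi)%VS 
    by rewrite -sumU; apply/subv_sumP => i _; apply/negPn/negP/kU.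
  by move=> /subvP/(_ one (memvf _)); rewrite memv_ker chi1 oner_eq0.
have [_ sUi minUi] := simU i; case: modA => mull mulr mul1 mulA.
exists u; split; last by apply/eqP; rewrite -memv_ker.
move=> a; apply/eqP; rewrite -subr_eq0 -memv0.
have sK : stable_subspace mul (U i :&: lker chi)%VS.
  move=> b v; rewrite !memv_cap => /andP[/sUi-> /=].
  by rewrite !memv_ker chiM => /eqP->; rewrite mulr0.
(* In the first case the zero space of the goal is rewritten back to U_i ∩ ker χ; in the second, [u]
   would lie in ker χ. *)
have [<-|eqU] := minUi _ (capvSl _ _) sK.
  rewrite memv_cap memvB ?memvZ ?sUi //= memv_ker linearB /= chiM linearZ /=.
  by rewrite subrr.
by move: ku; rewrite (subvP (capvSr (U i) (lker chi)) u) // eqU.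
Qed.

End Algebras.

(** * Hopf algebra identities under multilinear maps *)

Section Sweedler.
Variables (K : fieldType) (H : falgType K) (A : hopf H).
Local Notation Delta := (Delta A).
Local Notation eps := (eps A).
Local Notation S := (Sant A).

(** The form of coassociativity through which Sweedler indices are regrouped below. *)
Lemma coassoc_trilin (U : vectType K) (T : H -> H -> H -> U) (x : H) :
  (forall b c, islin (fun a => T a b c)) ->
  (forall a c, islin (fun b => T a b c)) ->
  (forall a b, islin (fun c => T a b c)) ->
  \tsum_(a, b <- Delta x) \tsum_(a1, a2 <- Delta a) T a1 a2 b =
  \tsum_(a, b <- Delta x) \tsum_(b1, b2 <- Delta b) T a b1 b2.
Proof.
move=> T1 T2 T3.
have := congr1 (tlift (fun a t => \tsum_(b, c <- t) T a b c)) (coassoc A x).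
have TE a b c : \tsum_(u, t <- a ⊗ (b ⊗ c)) \tsum_(v, w <- t) T u v w = T a b c.
  rewrite tlift_pure; last by bilin.
  by rewrite tlift_pure.
rewrite !tlift_tlift.
under eq_tlift => a b do
  [rewrite tlift_tlift; under eq_tlift => a1 a2 do rewrite TE].
move=> ->; apply: eq_tlift => a b.
by rewrite tlift_tlift; apply: eq_tlift => b1 b2; rewrite TE.
Qed.

Lemma Delta_mul (U : vectType K) (B : H -> H -> U) (x y : H) : bilin B ->
  \tsum_(a, b <- Delta (x * y)) B a b =
  \tsum_(a, b <- Delta x) \tsum_(c, d <- Delta y) B (a * c) (b * d).
Proof.
move=> bilB; rewrite DeltaM /tmul tlift_tlift; apply: eq_tlift => a b.
by rewrite tlift_tlift; apply: eq_tlift => c d; rewrite tlift_pure.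
Qed.

Lemma Delta_one (U : vectType K) (B : H -> H -> U) : bilin B ->
  \tsum_(a, b <- Delta 1) B a b = B 1 1.
Proof. by move=> bilB; rewrite Delta1 tlift_pure. Qed.

Lemma counitl_lin (U : vectType K) (f : H -> U) (x : H) : islin f ->
  \tsum_(a, b <- Delta x) (eps a *: f b) = f x.
Proof.
move=> fL; rewrite -[in RHS](counitl A x) (tlift_lin _ _ fL).
by apply: eq_tlift => a b; rewrite (islinZ fL).
Qed.

Lemma counitr_lin (U : vectType K) (f : H -> U) (x : H) : islin f ->
  \tsum_(a, b <- Delta x) (eps b *: f a) = f x.
Proof.
move=> fL; rewrite -[in RHS](counitr A x) (tlift_lin _ _ fL).
by apply: eq_tlift => a b; rewrite (islinZ fL).
Qed.

Lemma antipodel_lin (U : vectType K) (f : H -> U) (x : H) : islin f ->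
  \tsum_(a, b <- Delta x) f (S a * b) = eps x *: f 1.
Proof. by move=> fL; rewrite -(tlift_lin _ _ fL) antipodel (islinZ fL). Qed.

Lemma antipoder_lin (U : vectType K) (f : H -> U) (x : H) : islin f ->
  \tsum_(a, b <- Delta x) f (a * S b) = eps x *: f 1.
Proof. by move=> fL; rewrite -(tlift_lin _ _ fL) antipoder (islinZ fL). Qed.

Lemma antipode1 : S 1 = 1.
Proof.
have := antipodel A 1; rewrite (eps1 A) scale1r.
by rewrite (Delta_one (B := fun a b => S a * b)) ?mulr1 //; bilin.
Qed.

(* Stands in for the antimultiplicativity S(h y) = S(y) S(h), of which it is a
   consequence with a shorter proof. *)
Lemma antipode_mul_cancel (h y : H) :
  \tsum_(a, b <- Delta h) (S (a * y) * b) = eps h *: S y.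
Proof.
pose f c d := \tsum_(a, b <- Delta h) (S (a * c) * (b * d)).
(* Insert y_2 S(y_3) for the counit of the second leg of y; after regrouping, S(h_1 y_1) h_2 y_2 is
   the antipode axiom for h y_1, which leaves ε(h) S(y). *)
transitivity (\tsum_(c, d <- Delta y) \tsum_(d1, d2 <- Delta d) f c (d1 * S d2)).
  have fE c d : \tsum_(d1, d2 <- Delta d) f c (d1 * S d2) = eps d *: f c 1.
    by apply: (antipoder_lin (f := f c)); lin.
  under [RHS]eq_tlift => c d do rewrite fE.
  rewrite (counitr_lin (f := fun c => f c 1)) /f; last by lin.
  by apply: eq_tlift => a b; rewrite mulr1.
rewrite -(coassoc_trilin (T := fun c1 c2 d => f c1 (c2 * S d))); try by move=> *; lin.
transitivity (\tsum_(c, d <- Delta y) (eps c *: (eps h *: S d))).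
  apply: eq_tlift => c d.
  rewrite scalerA mulrC -(epsM A) -[S d in RHS]mul1r.
  rewrite -(antipodel_lin (f := fun z => z * S d)); last by lin.
  rewrite (Delta_mul (B := fun a b => S a * b * S d)); last by bilin.
  rewrite tlift_exchange; apply: eq_tlift => a b; apply: eq_tlift => c1 c2.
  by rewrite !mulrA.
by rewrite (counitl_lin (f := fun d => eps h *: S d)) //; lin.
Qed.

(* Likewise for Δ(S(y)) = S(y_2) ⊗ S(y_1). *)
Lemma antipode_comul_cancel (U : vectType K) (B : H -> H -> U) (y : H) : bilin B ->
  \tsum_(a, b <- Delta y) \tsum_(p, q <- Delta (S a)) B (p * b) q = B 1 (S y).
Proof.
move=> bilB; have [Bl Br] := bilB.
have linBl (V : vectType K) (g : V -> H) w : islin g -> islin (fun x => B (g x) w).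
  by move=> gL c u v; rewrite gL Bl.
have linBr (V : vectType K) (g : V -> H) w : islin g -> islin (fun x => B w (g x)).
  by move=> gL c u v; rewrite gL Br.
(* The left side is T(y_1, y_2, 1). Inserting y_3 S(y_4) as the last argument and regrouping gives
   Δ(S(y_1) y_2), which collapses by the antipode axiom. *)
pose T a b c := \tsum_(p, q <- Delta (S a)) B (p * b) (q * c).
transitivity (\tsum_(a, b <- Delta y) \tsum_(b', v <- Delta b)
    \tsum_(b1, u <- Delta b') T a b1 (u * S v)).
  apply: eq_tlift => a b.
  rewrite (coassoc_trilin (T := fun b1 u v => T a b1 (u * S v)));
    first last; try by move=> *; rewrite /T; lin; (apply: linBl || apply: linBr); lin.
  have TE b1 b2 : \tsum_(u, v <- Delta b2) T a b1 (u * S v) = eps b2 *: T a b1 1.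
    by apply: (antipoder_lin (f := T a b1)); rewrite /T; lin; (apply: linBl || apply: linBr); lin.
  under [RHS]eq_tlift => b1 b2 do rewrite TE.
  rewrite (counitr_lin (f := fun b1 => T a b1 1));
    last by rewrite /T; lin; (apply: linBl || apply: linBr); lin.
  by apply: eq_tlift => p q; rewrite mulr1.
rewrite -(coassoc_trilin (T := fun a b' v => \tsum_(b1, u <- Delta b') T a b1 (u * S v)));
  first last; try by move=> *; rewrite /T; lin; (apply: linBl || apply: linBr); lin.
transitivity (\tsum_(a, b <- Delta y) (eps a *: B 1 (S b))).
  apply: eq_tlift => a b.
  pose f z := \tsum_(r, s <- Delta z) B r (s * S b).
  have fE : f 1 = B 1 (S b).
    rewrite /f (Delta_one (B := fun r s => B r (s * S b))) ?mul1r //.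
    by split=> ?; [apply: linBl | apply: linBr]; lin.
  rewrite -fE -(antipodel_lin (f := f));
    last by rewrite /f; lin; (apply: linBl || apply: linBr); lin.
  apply: eq_tlift => a1 a2; rewrite /f.
  rewrite (Delta_mul (B := fun r s => B r (s * S b))); last first.
    by split=> ?; [apply: linBl | apply: linBr]; lin.
  rewrite tlift_exchange; apply: eq_tlift => p q; apply: eq_tlift => b1 u.
  by rewrite mulrA.
by rewrite (counitl_lin (f := fun b => B 1 (S b))) //; lin; (apply: linBl || apply: linBr); lin.
Qed.

End Sweedler.

(** * Integrals, cointegrals and the two Maschke criteria *)

Section Integrals.
Variables (K : fieldType) (H : falgType K) (A : hopf H).
Local Notation Delta := (Delta A).
Local Notation eps := (eps A).
Local Notation S := (Sant A).

Lemma regular_amodule : is_amodule (fun x y : H => x * y) 1 (fun x y => x * y).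
Proof.
split=> [c a b v|c a v w|v|a b v]; last by rewrite mulrA.
- by rewrite mulrDl scalerAl.
- by rewrite mulrDr scalerAr.
- by rewrite mul1r.
Qed.

(** Write h = ε(h_1) h_2 and ε(h_1) Λ = h_1 Λ. Then Λ_1 ⊗ S(Λ_2) h becomes h_1 Λ_1 ⊗ S(h_2 Λ_2) h_3,
    and [antipode_mul_cancel] absorbs h_2 and h_3. *)
Lemma cointegral_casimir (L : H) : left_cointegral A L -> forall h,
  \tsum_(a, b <- Delta L) ((h * a) ⊗ S b) = \tsum_(a, b <- Delta L) (a ⊗ (S b * h)).
Proof.
move=> LL h; apply/esym.
transitivity (\tsum_(u, v <- Delta h) \tsum_(a, b <- Delta (u * L)) (a ⊗ (S b * v))).
  rewrite -[LHS](counitl_lin A (f := fun v => \tsum_(a, b <- Delta L) (a ⊗ (S b * v))));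
    last by lin.
  by apply: eq_tlift => u v; rewrite LL linearZ tliftZ.
pose T u v w := \tsum_(a, b <- Delta L) ((u * a) ⊗ (S (v * b) * w)).
transitivity (\tsum_(u, v <- Delta h) \tsum_(u1, u2 <- Delta u) T u1 u2 v).
  apply: eq_tlift => u v.
  by rewrite (Delta_mul A (B := fun a b => a ⊗ (S b * v))) //; bilin.
rewrite (coassoc_trilin A (T := T)); try by move=> *; rewrite /T; lin.
transitivity (\tsum_(u, v <- Delta h) (eps v *: \tsum_(a, b <- Delta L) ((u * a) ⊗ S b))).
  apply: eq_tlift => u v; rewrite /T tlift_exchange.
  rewrite (tlift_lin (f := fun z : tens H H => eps v *: z)); last by lin.
  apply: eq_tlift => a b.
  rewrite -(tlift_lin (f := fun z => (u * a) ⊗ z)); last by lin.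
  rewrite antipode_mul_cancel (islinZ (f := fun z => (u * a) ⊗ z)) //; lin.
by rewrite (counitr_lin A (f := fun u => \tsum_(a, b <- Delta L) ((u * a) ⊗ S b))) //; lin.
Qed.

Lemma semisimple_cointegral (L : H) : two_sided_cointegral A L -> L <> 0 ->
  eps L <> 0 <-> semisimple H.
Proof.
move=> [LL LR] L0; split=> [/eqP epsL | ssH].
  apply: (separable_semisimple
    (e := (eps L)^-1 *: \tsum_(a, b <- Delta L) (a ⊗ S b))) => [h|].
    rewrite !tliftZ !tlift_tlift; congr (_ *: _).
    transitivity (\tsum_(a, b <- Delta L) ((h * a) ⊗ S b)).
      by apply: eq_tlift => a b; rewrite tlift_pure //; bilin.
    rewrite cointegral_casimir //.
    by apply: eq_tlift => a b; rewrite tlift_pure //; bilin.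
  rewrite tliftZ tlift_tlift.
  transitivity ((eps L)^-1 *: \tsum_(a, b <- Delta L) (a * S b)).
    by congr (_ *: _); apply: eq_tlift => a b; rewrite tlift_pure //; bilin.
  by rewrite antipoder scalerA mulVf // scale1r.
have [u [uL epsu]] := semisimple_character_eigenvector regular_amodule
  (epsM A) (eps1 A) ssH.
(* The two values of Λ u give ε(u) Λ = 0, although both factors are nonzero. *)
move=> epsL; have := uL L; rewrite LR epsL scale0r => /eqP.
by rewrite scaler_eq0 => /orP[] /eqP.
Qed.

Local Notation conv := (conv A).
Implicit Types (f g k lam mu : 'Hom(H, K^o)).

(** The product of scalars is written as the scalar action on [K^o], a form to which the scaling
    rules of [lin] apply. *)
Lemma convE f g x : conv f g x = \tsum_(a, b <- Delta x) (f a *: (g b : K^o)).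
Proof. by rewrite linfunE //; lin. Qed.

Lemma conv_amodule : is_amodule conv eps conv.
Proof.
split=> [c f g k|c f g k|f|f g k]; apply/lfunP => x.
- rewrite add_lfunE scale_lfunE !convE.
  have kL : islin (fun f => \tsum_(a, b <- Delta x) (f a *: (k b : K^o))) by lin.
  exact: kL.
- rewrite add_lfunE scale_lfunE !convE.
  have fL : islin (fun k => \tsum_(a, b <- Delta x) (f a *: (k b : K^o))) by lin.
  exact: fL.
- by rewrite convE (counitl_lin A (f := f)) //; lin.
rewrite !convE.
transitivity (\tsum_(a, b <- Delta x) \tsum_(a1, a2 <- Delta a)
    ((f a1 *: (g a2 : K^o)) *: (k b : K^o))).
  apply: eq_tlift => a b; rewrite convE.
  by rewrite (tlift_lin (f := fun z : K^o => z *: (k b : K^o))) //; lin.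
rewrite (coassoc_trilin A (T := fun a b c => (f a *: (g b : K^o)) *: (k c : K^o)));
  try by move=> *; lin.
apply: eq_tlift => a b; rewrite convE.
rewrite (tlift_lin (f := fun z : K^o => f a *: z)); last by lin.
by apply: eq_tlift => b1 b2; rewrite scalerA.
Qed.

(* Dual of [cointegral_casimir]. *)
Lemma integral_casimir lam : left_integral A lam -> forall x y,
  \tsum_(a, b <- Delta x) (lam (b * S y) *: a) =
  \tsum_(p, q <- Delta y) (lam (x * S p) *: q).
Proof.
move=> lamI x y; apply/esym.
(* The integral property of λ at x S(y_1) expands λ(x S(y_1)) 1; then [antipode_comul_cancel]
   removes S(y_1)_1 y_2. *)
transitivity (\tsum_(a, b <- Delta x) \tsum_(p, q <- Delta y)
    \tsum_(c, d <- Delta (S p)) (lam (b * d) *: (a * (c * q)))).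
  rewrite -tlift_exchange; apply: eq_tlift => p q.
  rewrite -[q in LHS]mul1r scalerAl -lamI.
  rewrite (tlift_lin (f := fun z => z * q)); last by lin.
  rewrite (Delta_mul A (B := fun a b => lam b *: a * q)); last by bilin.
  apply: eq_tlift => a b; apply: eq_tlift => c d.
  by rewrite -scalerAl mulrA.
apply: eq_tlift => a b.
rewrite (antipode_comul_cancel A (B := fun c d => lam (b * d) *: (a * c))).
  by rewrite mulr1.
by bilin.
Qed.

(** Setting x = 1 in [integral_casimir] gives λ(S(y)) 1 = λ(S(y_1)) y_2; now apply f. Thus λ ∘ S is
    a right integral. *)
Lemma right_integral_conv lam : left_integral A lam -> forall f,
  conv (linfun (fun x => lam (S x))) f = f 1 *: linfun (fun x => lam (S x)).
Proof.
move=> lamI f; have lamSL : islin (fun x => lam (S x)) by lin.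
apply/lfunP => x; rewrite scale_lfunE convE linfunE //.
transitivity (f (lam (S x) *: 1)); last by rewrite linearZ; exact: mulrC.
have := integral_casimir lamI 1 x.
rewrite (Delta_one A (B := fun a b => lam (b * S x) *: a)) ?mul1r; last by bilin.
move=> ->; rewrite (tlift_lin (f := f)); last by lin.
by apply: eq_tlift => a b; rewrite linearZ linfunE // mul1r.
Qed.

Lemma integral_cosemisimple lam : left_integral A lam -> lam 1 <> 0 ->
  cosemisimple A.
Proof.
move=> lamI /eqP lam1.
(* With b_i the chosen basis, Σ e_i ⊗ b_i^* is the tensor of the bilinear form λ(x S(y)). *)
have [e eE] : exists e : 'I_(\dim {:H}) -> 'Hom(H, K^o),
    forall i x, e i x = lam (x * S (basis_vec i)).
  exists (fun i => linfun (fun x => lam (x * S (basis_vec i)))) => i x.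
  by rewrite linfunE //; lin.
have convl g : islin (conv^~ g).
  by move=> c f k; case: conv_amodule => -> .
have convr g : islin (conv g).
  by move=> c f k; case: conv_amodule => _ ->.
have bilc : bilin (fun f g => conv f g) by [].
(* [integral_casimir] read in the dual algebra: left multiplication by f on the e_i has the
   transposed matrix of right multiplication by f on the dual basis. *)
have convel f j : conv f (e j) = \sum_i conv (dual_basis_vec i) f (basis_vec j) *: e i.
  apply/lfunP => x; rewrite convE sum_lfunE.
  transitivity (f (\tsum_(a, b <- Delta x) (lam (b * S (basis_vec j)) *: a))).
    rewrite (tlift_lin (f := f)); last by lin.
    by apply: eq_tlift => a b; rewrite linearZ eE; exact: mulrC.
  rewrite integral_casimir // (tlift_lin (f := f)); last by lin.
  under [RHS]eq_bigr => i _.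
    rewrite scale_lfunE convE eE.
    rewrite (tlift_lin (f := fun z : K^o => z *: (lam (x * S (basis_vec i)) : K^o)));
      last by lin.
    over.
  rewrite /= -(tlift_sum_body).
  apply: eq_tlift => p q; rewrite linearZ.
  transitivity (f q *: (lam (x * S p) : K^o)); first exact: mulrC.
  rewrite -(dual_basis_expansion (f := fun z => lam (x * S z))); last by lin.
  rewrite scaler_sumr; apply: eq_bigr => i _.
  by rewrite scalerA; congr (_ *: _); exact: mulrC.
apply: (separable_semisimple (e := (lam 1)^-1 *: \sum_i (e i ⊗ dual_basis_vec i))).
  move=> f; rewrite !tliftZ !tlift_sum; congr (_ *: _).
  under eq_bigr => i _.
    rewrite (tlift_pure (B := fun g k => conv f g ⊗ k)); last first.
      by split=> w; [apply: islin_tpurel | apply: islin_tpurer].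
    rewrite convel; over.
  under [RHS]eq_bigr => i _.
    rewrite (tlift_pure (B := fun g k => g ⊗ conv k f)); last first.
      by split=> w; [apply: islin_tpurel | apply: islin_tpurer].
    rewrite -[conv _ f]lfun_dual_basis.
    rewrite (islin_sum (f := fun z => e i ⊗ z)); last by lin.
    over.
  rewrite /= [RHS]exchange_big; apply: eq_bigr => j _.
  rewrite (islin_sum (f := fun z => z ⊗ dual_basis_vec j)); last by lin.
  apply: eq_bigr => i _.
  rewrite (islinZ (f := fun z => z ⊗ dual_basis_vec j)); last by lin.
  by rewrite (islinZ (f := fun z => e i ⊗ z)) //; lin.
(* The product of the two legs sends x to λ(x_1 S(x_2)) = ε(x) λ(1), hence the factor λ(1)^-1. *)
rewrite tliftZ tlift_sum; apply/lfunP => x.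
rewrite scale_lfunE sum_lfunE.
under eq_bigr => i _ do rewrite tlift_pure // convE.
rewrite -tlift_sum_body.
transitivity ((lam 1)^-1 *: \tsum_(a, b <- Delta x) lam (a * S b)).
  congr (_ *: _); apply: eq_tlift => a b.
  rewrite -(dual_basis_expansion (f := fun z => lam (a * S z))); last by lin.
  by apply: eq_bigr => i _; rewrite eE; exact: mulrC.
rewrite (antipoder_lin A (f := lam)); last by lin.
rewrite scalerA mulrC -scalerA [_ *: lam 1]mulVf //; exact: mulr1.
Qed.

(** Evaluation at 1 is the counit of the dual algebra and supplies the character. If λ(1) = 0, the
    two values of the product of λ ∘ S with u give u(1) λ(S(x)) = 0 for all x, which fails at x =
    L. *)
Lemma cosemisimple_integral lam (L : H) : left_integral A lam ->
  Sant A L = L -> lam L <> 0 -> cosemisimple A -> lam 1 <> 0.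
Proof.
move=> lamI SL lamL ssA.
have evL : islin (fun f : 'Hom(H, K^o) => f 1) by lin.
have chiE f : linfun (fun f : 'Hom(H, K^o) => f 1) f = f 1 by rewrite linfunE.
have [||u [uI u1]] := semisimple_character_eigenvector
  (chi := linfun (fun f : 'Hom(H, K^o) => f 1)) conv_amodule _ _ ssA.
- move=> f g; rewrite !chiE convE.
  by rewrite (Delta_one A (B := fun a b => f a *: (g b : K^o))) //; bilin.
- by rewrite chiE (eps1 A).
have lamSL : islin (fun x => lam (S x)) by lin.
move=> lam1; have := right_integral_conv lamI u.
rewrite uI chiE (linfunE lamSL) antipode1 lam1 scale0r => /lfunP/(_ L).
rewrite scale_lfunE zero_lfunE (linfunE lamSL) SL => /esym/eqP.
by rewrite scaler_eq0 => /orP[/eqP|/eqP //]; rewrite -chiE.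
Qed.

End Integrals.

(** * The intertwiners Φ and the values of the functor *)

Section KerlerLyubashenko.
Variables (K : fieldType) (H : falgType K) (A : ribbon_hopf H).

Definition regular_rep : hrep H := @HRep K H H (fun x y => x * y).

Lemma regular_rep_hmodule : hmodule regular_rep.
Proof. exact: regular_amodule. Qed.

Lemma hact_islin_l (V : hrep H) (v : V) : hmodule V -> islin (fun h => hact h v).
Proof. by case=> Vl _ _ _ c g h; rewrite Vl. Qed.

Lemma jmap_islin (V : hrep H) : hmodule V -> islin (jmap A V).
Proof.
move=> modV; apply: islin_sumr => i; apply: islin_tpurel.
exact: hact_islin_l.
Qed.

(** [J4_Phi] is a choice with default value 0, so exhibiting one solution is what gives it the
    defining equation. *)
Lemma J4_PhiP (D : kirby)
    (Phi : 'Hom(adpow A (size (kdiscs D)), adpow A (size (iota 0 (kcomps D))))) :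
  is_Phi Phi -> is_Phi (J4_Phi A D).
Proof. by move=> PhiP; apply: (xgetPex 0 (ex_intro _ Phi PhiP)). Qed.

(* Evaluating the dual factor at 1 inverts j on the regular representation. *)
Lemma j_top1_inj (t t' : adpow A 1) :
  j_top (fun=> regular_rep) (cs := [:: 0]) t =
  j_top (fun=> regular_rep) (cs := [:: 0]) t' -> t = t'.
Proof.
pose rho (z : tens H (tens 'Hom(H, K^o) K^o)) : tens H K^o :=
  tlift (fun (v : H) s => tlift (fun (f : 'Hom(H, K^o)) (r : K^o) =>
    v ⊗ ((f 1 : K) *: r)) s) z.
suff rhoK (u : adpow A 1) :
    rho (j_top (fun=> regular_rep) (cs := [:: 0]) u) = u.
  by move=> tt'; rewrite -[t]rhoK tt' rhoK.
have rhoL : islin rho by rewrite /rho; lin.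
rewrite -[RHS]tlift_id /= (tlift_lin _ _ rhoL); apply: eq_tlift => x r.
rewrite (tlift_lin _ _ rhoL) /jmap tlift_sum.
transitivity ((\sum_i (dual_basis_vec i (1 : H) : K) *: (x * basis_vec i)) ⊗ (r : K^o)).
  rewrite (islin_sum (f := fun z => z ⊗ (r : K^o))); last by lin.
  apply: eq_bigr => i _; rewrite tlift_pure; last first.
    by split=> w; rewrite /rho; lin.
  rewrite /rho tlift_pure; last by bilin.
  rewrite tlift_pure; last by bilin.
  rewrite (islinZ (f := fun z => z ⊗ (r : K^o))); last by lin.
  by rewrite (islinZ (f := fun z : K^o => (x * basis_vec i) ⊗ z)) //; lin.
by rewrite (dual_basis_expansion (f := fun z => x * z)) ?mulr1 //; lin.
Qed.

(** The cup evaluates to the coevaluation Σ v_i ⊗ f_i, which is j_X(1); equivariance is h ▷ 1 = h_1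
    S(h_2) = ε(h) 1. *)
Lemma S2xD2_Phi : @is_Phi K H A S2xD2
  (linfun (fun t : K^o => (1 : H) ⊗ t) : 'Hom(triv A, adpow A 1)).
Proof.
have PhiL : islin (fun t : K^o => (1 : H) ⊗ t) by lin.
split=> [h v|X modX t].
  rewrite !linfunE //=.
  transitivity (\tsum_(a, b <- Delta A h)
    ((eps A b : K) *: (((eps A a : K) *: (1 : H)) ⊗ (v : K^o)))).
    rewrite (counitr_lin A (f := fun a => ((eps A a : K) *: (1 : H)) ⊗ (v : K^o))); last by lin.
    rewrite (islinZ (f := fun z => z ⊗ (v : K^o))); last by lin.
    by rewrite (islinZ (f := fun z : K^o => (1 : H) ⊗ z)) //; lin.
  apply: eq_tlift => a b.
  rewrite (tlift_pure (B := fun (x : H) (w : K^o) =>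
    (\tsum_(c, d <- Delta A a) (c * x * Sant A d)) ⊗ ((eps A b : K) *: w))); last by bilin.
  rewrite (islinZ (f := fun z : K^o => _ ⊗ z)); last by lin.
  congr (_ *: (_ ⊗ _)).
  by rewrite -(antipoder A); apply: eq_tlift => c d; rewrite mulr1.
have jL := jmap_islin (modX 0).
rewrite linfunE //= tlift_pure; last by bilin.
rewrite /cup_vec /jmap; congr (tlift _ _); apply: eq_bigr => i _.
by case: (modX 0) => _ _ ->.
Qed.

Lemma J4_S2xD2 lam (L : H) : J4 A lam L S2xD2 = lam 1.
Proof.
have [_ PhiE] := S2xD2_Phi; have [_ JE] := J4_PhiP S2xD2_Phi.
have modX : forall s : nat, hmodule ((fun=> regular_rep) s).
  by move=> _; exact: regular_rep_hmodule.
(* The chosen Φ and the explicit one have the same image under j of the regular representation,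
   which is injective. *)
have PhiJ : J4_Phi A S2xD2 (1 : K^o) = (1 : H) ⊗ (1 : K^o).
  apply: j_top1_inj.
  rewrite -[LHS](JE _ modX 1) (PhiE _ modX 1) linfunE //; lin.
rewrite /J4 [Lam_pow _ _ _]/= PhiJ /=.
rewrite (tlift_pure (B := fun (x : H) (r : K^o) => lam x * r : K^o)) ?mulr1 //.
split=> w c u v; first by rewrite linearP mulrDl -scalerAl.
by rewrite mulrDr -scalerAr.
Qed.

(** Equivariance of ε : ad → K, from ε(h_1 x S(h_2)) = ε(x) ε(h_1 S(h_2)). *)
Lemma eps_ad (h x : H) : eps A (hact (h := adrep A) h x) = eps A h * eps A x.
Proof.
rewrite /= (tlift_lin (f := eps A)); last by lin.
transitivity (\tsum_(a, b <- Delta A h) (eps A x *: (eps A (a * Sant A b) : K^o))).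
  apply: eq_tlift => a b; rewrite !(epsM A) [RHS]mulrCA.
  by rewrite mulrA.
rewrite (antipoder_lin A (f := fun z => eps A x *: (eps A z : K^o))); last by lin.
by rewrite (eps1 A) scalerA; exact: mulr1.
Qed.

(** No strand crosses the disc, so the bottom block is coloured by the trivial module, on which j
    sends x to ε(x) times the coevaluation of K. *)
Lemma S1xD3_Phi : @is_Phi K H A S1xD3
  (linfun (fun t : tens H K^o => \tsum_(x, r <- t) (eps A x *: (r : K^o))) :
    'Hom(adpow A 1, triv A)).
Proof.
have PhiL : islin (fun t : tens H K^o => \tsum_(x, r <- t) (eps A x *: (r : K^o))).
  by lin.
split=> [h v|X _ t].
  rewrite !linfunE //= tlift_tlift.
  rewrite -(counitl_lin A (f := fun b => eps A b *:
    \tsum_(x, r <- v) (eps A x *: (r : K^o)))); last by lin.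
  apply: eq_tlift => a b; rewrite tlift_tlift scalerA.
  rewrite (tlift_lin (f := fun z : K^o => (eps A a * eps A b) *: z)); last by lin.
  apply: eq_tlift => x r; rewrite tlift_pure; last by bilin.
  by rewrite (eps_ad a x) !scalerA mulrAC.
rewrite linfunE //=; apply: eq_tlift => x r.
rewrite /jmap tlift_sum.
transitivity (eps A x *: (\sum_i (dual_basis_vec i (1 : K^o) *: basis_vec i) *: r)).
  rewrite scaler_sumr; apply: eq_bigr => i _.
  rewrite tlift_pure /=; last first.
    by split=> w; [apply: islin_scalel | apply: islin_scaler]; lin.
  by rewrite !scalerA -mulrA (mulrC (basis_vec i)).
congr (_ *: _); rewrite -scaler_suml.
rewrite (dual_basis_expansion (f := fun z : K^o => z)) ?scale1r //.
Qed.

Lemma J4_S1xD3 lam (L : H) : J4 A lam L S1xD3 = eps A L.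
Proof.
have [_ PhiE] := S1xD3_Phi; have [_ JE] := J4_PhiP S1xD3_Phi.
have modX : forall s : nat, hmodule ((fun=> regular_rep) s).
  by move=> _; exact: regular_rep_hmodule.
(* With no arc at the top, [j_top] is the identity and the defining equation gives the values of Φ
   directly. *)
have PhiJ t : J4_Phi A S1xD3 t = \tsum_(x, r <- t) (eps A x *: (r : K^o)).
  rewrite -[LHS](JE _ modX t) (PhiE _ modX t) linfunE //; lin.
rewrite /J4 PhiJ /= tlift_pure; last by bilin.
exact: mulr1.
Qed.

End KerlerLyubashenko.

Theorem corollary8p2 (K : closedFieldType) (H : falgType K) (A : ribbon_hopf H)
    (lam : 'Hom(H, K^o)) (L : H)
    (unimodH : unimodular A)
    (lam_int : left_integral A lam)
    (L_coint : two_sided_cointegral A L)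
    (lamL : lam L = 1) :
  [/\ J4 A lam L S2xD2 = lam 1,
      J4 A lam L S1xD3 = eps A L,
      J4 A lam L S2xD2 <> 0 <-> cosemisimple A
    & J4 A lam L S1xD3 <> 0 <-> semisimple H].
Proof.
(* From λ(Λ) = 1 come Λ ≠ 0, used for H, and λ(S(Λ)) ≠ 0, used for the dual algebra together with
   unimodularity. *)
have lamL0 : lam L <> 0 by rewrite lamL; apply/eqP/oner_neq0.
rewrite J4_S2xD2 J4_S1xD3; split=> //.
  split; first exact: integral_cosemisimple.
  by apply: cosemisimple_integral lamL0 => //; apply: unimodH; case: L_coint.
by apply: semisimple_cointegral => // L0; apply: lamL0; rewrite L0 linear0.
Qed.
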